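(* Let $\mathcal{G}$ be the set of partitions $\lambda=(\lambda_1>\lambda_2>\cdots>\lambda_\ell)$ into distinct positive parts (empty partition included) such that $\lambda_{2i}-\lambda_{2i+1}$ is even whenever $2i+1\le\ell$, and, if $\ell$ is even, the smallest part $\lambda_\ell$ is even. For a partition let $|\lambda_o|=\lambda_1+\lambda_3+\lambda_5+\cdots$ (sum of odd-indexed parts) and $|\lambda_e|=\lambda_2+\lambda_4+\cdots$ (sum of even-indexed parts). Then $$\sum_{\lambda\in\mathcal{G}}x^{|\lambda_{o}|}y^{|\lambda_{e}|}=\sum_{n=0}^{\infty}\frac{x^{\frac{3n^2-n}{2}}y^{\frac{3n^2-3n}{2}}}{(x;xy)_n(x^2y^2;x^2y^2)_{n}}.$$
   Context: $(a;t)_n=\prod_{i=0}^{n-1}(1-at^i)$; identity of formal power series in $x,y$. *)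

(* Defs.v *)
From HB Require Import structures.
From mathcomp Require Import all_boot all_order all_algebra.
From mathcomp Require Import boolp classical_sets functions cardinality fsbigop.

Set Implicit Arguments.
Unset Strict Implicit.
Unset Printing Implicit Defensive.

Import GRing.Theory.
Local Open Scope ring_scope.

Record fps (R : Type) : Type := FPS { fcoef : nat -> R }.

Notation "{ 'fps' R }" := (fps R) (at level 0, format "{ 'fps'  R }").

HB.instance Definition _ (R : Type) := gen_eqMixin (fps R).
HB.instance Definition _ (R : Type) := gen_choiceMixin (fps R).

Lemma fpsP (R : Type) (f g : {fps R}) : fcoef f =1 fcoef g <-> f = g.
Proof. by split=> [|->//]; case: f g => f [g] /= /funext ->. Qed.

Section FpsZmodule.
Variable R : zmodType.
Implicit Types f g h : {fps R}.

Definition fps_zero : {fps R} := FPS (fun=> 0).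
Definition fps_opp f : {fps R} := FPS (fun n => - fcoef f n).
Definition fps_add f g : {fps R} := FPS (fun n => fcoef f n + fcoef g n).

Fact fps_addA : associative fps_add.
Proof. by move=> f g h; apply/fpsP => n /=; rewrite addrA. Qed.
Fact fps_addC : commutative fps_add.
Proof. by move=> f g; apply/fpsP => n /=; rewrite addrC. Qed.
Fact fps_add0 : left_id fps_zero fps_add.
Proof. by move=> f; apply/fpsP => n /=; rewrite add0r. Qed.
Fact fps_addN : left_inverse fps_zero fps_opp fps_add.
Proof. by move=> f; apply/fpsP => n /=; rewrite addNr. Qed.

HB.instance Definition _ :=
  GRing.isZmodule.Build {fps R} fps_addA fps_addC fps_add0 fps_addN.

Lemma fcoef0 n : fcoef (0 : {fps R}) n = 0. Proof. by []. Qed.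
Lemma fcoefD f g n : fcoef (f + g) n = fcoef f n + fcoef g n. Proof. by []. Qed.
Lemma fcoefN f n : fcoef (- f) n = - fcoef f n. Proof. by []. Qed.
Lemma fcoefB f g n : fcoef (f - g) n = fcoef f n - fcoef g n. Proof. by []. Qed.

End FpsZmodule.

Section FpsRing.
Variable R : comNzRingType.
Implicit Types f g h : {fps R}.

Definition fps_one : {fps R} := FPS (fun n => (n == 0)%:R).
Definition fps_mul f g : {fps R} :=
  FPS (fun n => \sum_(i < n.+1) fcoef f i * fcoef g (n - i)).

Definition fps_trunc N f : {poly R} := \poly_(i < N) fcoef f i.

Fact fps_truncM N f g n : (n < N)%N ->
  fcoef (fps_mul f g) n = (fps_trunc N f * fps_trunc N g)`_n.
Proof.
move=> ltnN; rewrite coefM /=; apply: eq_bigr => i _.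
rewrite !coef_poly (leq_ltn_trans _ ltnN) ?(leq_ltn_trans _ ltnN) ?leq_subr //.
by rewrite -ltnS.
Qed.

Fact fps_mulC : commutative fps_mul.
Proof.
by move=> f g; apply/fpsP => n; rewrite !(@fps_truncM n.+1) // mulrC.
Qed.

Fact fps_mulA : associative fps_mul.
Proof.
move=> f g h; apply/fpsP => n; rewrite !(@fps_truncM n.+1) //.
transitivity (fps_trunc n.+1 f * (fps_trunc n.+1 g * fps_trunc n.+1 h))`_n.
  rewrite !coefM; apply: eq_bigr => i _; congr (_ * _).
  by rewrite coef_poly ltnS leq_subr (@fps_truncM n.+1) // ltnS leq_subr.
rewrite mulrA !coefM; apply: eq_bigr => i _; congr (_ * _).
by rewrite coef_poly ltn_ord (@fps_truncM n.+1).
Qed.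

Fact fps_mul1 : left_id fps_one fps_mul.
Proof.
move=> f; apply/fpsP => n /=; rewrite big_ord_recl /= mul1r subn0 big1 ?addr0 //.
by move=> i _; rewrite mul0r.
Qed.

Fact fps_mulDl : left_distributive fps_mul +%R.
Proof.
move=> f g h; apply/fpsP => n /=; rewrite -big_split /=.
by apply: eq_bigr => i _; rewrite mulrDl.
Qed.

Fact fps_oner_neq0 : fps_one != 0.
Proof.
apply/eqP => /(congr1 (fun f : {fps R} => fcoef f 0)) /= /eqP.
by rewrite oner_eq0.
Qed.

HB.instance Definition _ := GRing.Zmodule_isComNzRing.Build {fps R}
  fps_mulA fps_mulC fps_mul1 fps_mulDl fps_oner_neq0.

Lemma fcoef1 n : fcoef (1 : {fps R}) n = (n == 0)%:R. Proof. by []. Qed.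
Lemma fcoefM f g n :
  fcoef (f * g) n = \sum_(i < n.+1) fcoef f i * fcoef g (n - i).
Proof. by []. Qed.
Lemma fcoef0M f g : fcoef (f * g) 0 = fcoef f 0 * fcoef g 0.
Proof. by rewrite fcoefM big_ord1. Qed.

Definition fpsC (c : R) : {fps R} := FPS (fun n => if n == 0 then c else 0).
Definition fpsX : {fps R} := FPS (fun n => (n == 1)%:R).

End FpsRing.

Section FpsUnit.
Variable R : comUnitRingType.
Implicit Types f g : {fps R}.

(* A power series is invertible iff its constant coefficient is; the first n
   coefficients of the inverse are listed by solving (f * f^-1)_k = [k = 0]
   for k < n. *)
Fixpoint fps_inv_seq f (n : nat) : seq R :=
  if n is m.+1 then
    let s := fps_inv_seq f m in
    rcons s ((fcoef f 0)^-1
             * ((m == 0)%:R - \sum_(i < m) fcoef f (m - i) * s`_i))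
  else [::].

Definition fps_unit : {pred {fps R}} := fun f => fcoef f 0 \is a GRing.unit.
Definition fps_inv f : {fps R} :=
  if f \in fps_unit then FPS (fun n => (fps_inv_seq f n.+1)`_n) else f.

Fact size_fps_inv_seq f n : size (fps_inv_seq f n) = n.
Proof. by elim: n => //= n IHn; rewrite size_rcons IHn. Qed.

Fact nth_fps_inv_seq f n k : (k < n)%N ->
  (fps_inv_seq f n)`_k = (fps_inv_seq f k.+1)`_k.
Proof.
elim: n => // n IHn; rewrite ltnS leq_eqVlt => /predU1P[-> //|ltkn].
by rewrite [in LHS]/= nth_rcons size_fps_inv_seq ltkn IHn.
Qed.

Fact fps_mulVf : {in fps_unit, left_inverse 1 fps_inv *%R}.
Proof.
move=> f Uf; rewrite mulrC; apply/fpsP => n; rewrite fcoefM /fps_inv Uf.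
rewrite (reindex_inj rev_ord_inj) big_ord_recr /= !subSS subnn subn0.
rewrite nth_rcons size_fps_inv_seq ltnn eqxx mulVKr //.
rewrite addrC -addrA [X in _ + X](_ : _ = 0) ?addr0 ?fcoef1 //.
apply/eqP; rewrite addrC subr_eq0; apply/eqP; apply: eq_bigr => i _.
by rewrite subSS subKn 1?ltnW // -/(fps_inv_seq f i.+1) [in RHS]nth_fps_inv_seq.
Qed.

Fact fps_unitPl f g : g * f = 1 -> fps_unit f.
Proof.
move=> /(congr1 (fun h : {fps R} => fcoef h 0)); rewrite fcoef0M fcoef1 => gf1.
by apply/unitrPr; exists (fcoef g 0); rewrite mulrC.
Qed.

Fact fps_inv_out : {in [predC fps_unit], fps_inv =1 id}.
Proof. by move=> f; rewrite inE /= /fps_inv => /negPf->. Qed.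

HB.instance Definition _ := GRing.ComNzRing_hasMulInverse.Build {fps R}
  fps_mulVf fps_unitPl fps_inv_out.

Lemma fps_unitE f : (f \is a GRing.unit) = (fcoef f 0 \is a GRing.unit).
Proof. by []. Qed.

End FpsUnit.

(* R[[x, y]] is realized as (R[[y]])[[x]]: the outer variable is x, and the
   variable of the coefficient ring is y. *)
Definition fps2X (R : comNzRingType) : {fps {fps R}} := fpsX {fps R}.
Definition fps2Y (R : comNzRingType) : {fps {fps R}} := fpsC (fpsX R).

(* The coefficient of x^a y^b. *)
Definition fcoef2 (R : Type) (f : {fps {fps R}}) (a b : nat) : R :=
  fcoef (fcoef f a) b.

(* Formal sums of families (F i), i in A, of power series: each monomial must
   occur in only finitely many members, and coefficients are added up. The
   value of fps2_sum is meaningful only for summable families (\sum_(i \in A)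
   is 0 when infinitely many terms are nonzero). *)
Definition fps2_summable (R : comNzRingType) (I : choiceType) (A : set I)
    (F : I -> {fps {fps R}}) : Prop :=
  forall a b : nat,
    finite_set [set i | A i /\ fcoef2 (F i) a b <> 0]%classic.

Definition fps2_sum (R : comNzRingType) (I : choiceType) (A : set I)
    (F : I -> {fps {fps R}}) : {fps {fps R}} :=
  FPS (fun a => FPS (fun b => \sum_(i \in A) fcoef2 (F i) a b)).

(* (a; t)_n *)
Definition qpoch (R : nzRingType) (a t : R) (n : nat) : R :=
  \prod_(i < n) (1 - a * t ^+ i).

(* A partition is the sequence of its positive parts, in decreasing order;
   parts are numbered from 1. *)
Definition part (la : seq nat) (i : nat) : nat := nth 0%N la i.-1.

Definition distinct_partition (la : seq nat) : bool :=
  sorted gtn la && (0%N \notin la).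

Definition calG : set (seq nat) :=
  [set la | [/\ distinct_partition la,
     (forall i, (1 <= i)%N -> ((2 * i).+1 <= size la)%N ->
        ~~ odd (part la (2 * i) - part la (2 * i).+1))
   & ((0 < size la)%N -> ~~ odd (size la) -> ~~ odd (part la (size la)))]]%classic.

Definition odd_weight (la : seq nat) : nat :=
  (\sum_(1 <= i < (size la).+1 | odd i) part la i)%N.
Definition even_weight (la : seq nat) : nat :=
  (\sum_(1 <= i < (size la).+1 | ~~ odd i) part la i)%N.

Lemma qpoch_fps_unit (R : comUnitRingType) (a t : {fps R}) n :
  fcoef a 0 = 0 -> qpoch a t n \is a GRing.unit.
Proof.
move=> a0; apply: rpred_prod => i _.
by rewrite fps_unitE fcoefB fcoef1 fcoef0M a0 mul0r subr0 unitr1.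
Qed.

(* Main.v *)
Require Import Defs.
From mathcomp Require Import all_boot all_order all_algebra.
From mathcomp Require Import boolp classical_sets functions cardinality fsbigop.
From mathcomp Require Import zify.
Import GRing.Theory.
Local Open Scope ring_scope.

Set Implicit Arguments.
Unset Strict Implicit.

(* Cut a partition la of G into pairs (la_1, la_2), (la_3, la_4), ..., the last
   pair being completed by 0 if the number of parts is odd, and let G_n be the
   set of those with n pairs. A member of G_(n+1) is a member mu of G_n with a
   pair b + d + 1 > b on top of it, where b = mu_1 + 2 [n > 0] + 2 c, and c, d
   are free. Weighting la by x^(|la_o| + k la_1) y^(|la_e| + k la_1), the sums
   S_(n,k) over G_n therefore satisfy, with e = 2 [n > 0],
     (1 - x^(k+1) y^k) (1 - (xy)^(2(k+1))) S_(n+1,k)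
       = x^((k+1)(e+1)) y^((k+1)e+k) S_(n,k+1),
   which determines them; S_(n,0) is the n-th summand of the right-hand side.
   The two factors on the left are geometric series: if A * nat is weighted by
   w(i) m^j, splitting off j = 0 gives S(A * nat) = S(A) + m S(A * nat). *)

(** * Coefficients of monomials and of their multiples *)

Lemma fcoef_fpsXnM (R : comNzRingType) (f : {fps R}) p n :
  fcoef (fpsX R ^+ p * f) n = if (p <= n)%N then fcoef f (n - p) else 0.
Proof.
elim: p n => [|p IHp] n; first by rewrite expr0 mul1r subn0.
rewrite exprS -mulrA; move: (fpsX R ^+ p * f) IHp => g IHp.
rewrite fcoefM; case: n => [|n]; first by rewrite big_ord1 mul0r.
rewrite !big_ord_recl /= mul0r add0r mul1r big1 ?addr0; last first.
  by move=> i _; rewrite mul0r.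
by rewrite subn1 /= IHp ltnS subSS.
Qed.

Lemma fcoef_fpsCXnM (R : comNzRingType) (c : R) (f : {fps R}) q n :
  fcoef (fpsC c ^+ q * f) n = c ^+ q * fcoef f n.
Proof.
elim: q n => [|q IHq] n; first by rewrite !expr0 !mul1r.
rewrite !exprS -!mulrA -IHq; move: (fpsC c ^+ q * f) => g.
rewrite fcoefM big_ord_recl /= subn0 big1 ?addr0 //.
by move=> i _; rewrite mul0r.
Qed.

Section Monomials.
Variable R : comNzRingType.
Implicit Types f : {fps {fps R}}.

Lemma fcoef2D f g a b : fcoef2 (f + g) a b = fcoef2 f a b + fcoef2 g a b.
Proof. by []. Qed.

Lemma fps2P f g : (forall a b, fcoef2 f a b = fcoef2 g a b) -> f = g.
Proof. by move=> fg; apply/fpsP => a; apply/fpsP => b; apply: fg. Qed.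

Definition mon p q : {fps {fps R}} := fps2X R ^+ p * fps2Y R ^+ q.

Lemma monM p q p' q' : mon p q * mon p' q' = mon (p + p') (q + q').
Proof. by rewrite /mon !exprD mulrACA. Qed.

Lemma monX p q n : mon p q ^+ n = mon (p * n) (q * n).
Proof. by rewrite /mon exprMn -!exprM. Qed.

Lemma fcoef2_monM p q f a b :
  fcoef2 (mon p q * f) a b =
    if (p <= a)%N && (q <= b)%N then fcoef2 f (a - p) (b - q) else 0.
Proof.
rewrite /fcoef2 /mon -mulrA fcoef_fpsXnM; case: leqP => // _.
by rewrite /fps2Y fcoef_fpsCXnM fcoef_fpsXnM andTb.
Qed.

Lemma fcoef2_mon p q a b :
  fcoef2 (mon p q) a b = ((p == a) && (q == b))%:R.
Proof.
rewrite -[mon p q]mulr1 fcoef2_monM /fcoef2 fcoef1.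
case: (leqP p a) => [pa|ap] /=; last by rewrite (gtn_eqF ap).
case: (leqP q b) => [qb|bq] /=; last by rewrite (gtn_eqF bq) andbF.
rewrite subn_eq0 [p == a]eqn_leq pa [q == b]eqn_leq qb /=.
(* The outer coefficient is a boolean read as a series in y, so it is 0 or 1, and in the latter case
   its own coefficient is still to be taken. *)
by case: (a <= p)%N; rewrite /= -?[_%:R]/(1 : {fps R}) ?fcoef1 ?subn_eq0.
Qed.

End Monomials.

(** * Formal sums, local finiteness and geometric series *)

Section FormalSums.
Local Open Scope classical_set_scope.
Variable R : comNzRingType.
Implicit Types I J : choiceType.

Lemma fps2_sumU I (A B : set I) (F : I -> {fps {fps R}}) :
  fps2_summable A F -> fps2_summable B F -> A `&` B `<=` set0 ->
  fps2_sum (A `|` B) F = fps2_sum A F + fps2_sum B F.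
Proof.
move=> sA sB AB; apply: fps2P => a b; rewrite fcoef2D /fcoef2 /=.
(* Only the supports are known to be finite, so the union is split after restricting to them. *)
rewrite fsbig_supp setIUl fsbigU0 //; [|exact: sA|exact: sB|].
  by rewrite -!fsbig_supp.
by move=> i [[Ai _] [Bi _]]; apply: AB.
Qed.

Lemma eq_fps2_sum I (A : set I) (F G : I -> {fps {fps R}}) :
  (forall i, A i -> F i = G i) -> fps2_sum A F = fps2_sum A G.
Proof.
move=> FG; apply: fps2P => a b; rewrite /fcoef2 /=.
by apply: eq_fsbigr => i; rewrite inE => Ai; rewrite FG.
Qed.

Lemma fps2_sum_set1 I (i : I) (F : I -> {fps {fps R}}) :
  fps2_sum [set i] F = F i.
Proof. by apply: fps2P => a b; rewrite /fcoef2 /= fsbig_set1. Qed.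

Lemma fps2_sum_image I J (A : set I) (h : I -> J) (F : J -> {fps {fps R}}) :
  set_inj A h -> fps2_sum (h @` A) F = fps2_sum A (F \o h).
Proof. by move=> hI; apply: fps2P => a b; rewrite /fcoef2 /= fsbig_image. Qed.

Lemma fps2_sum_monM I (A : set I) p q (F : I -> {fps {fps R}}) :
  fps2_sum A (fun i => mon R p q * F i) = mon R p q * fps2_sum A F.
Proof.
apply: fps2P => a b; rewrite fcoef2_monM /fcoef2 /=.
under eq_fsbigr do rewrite -/(fcoef2 _ a b) fcoef2_monM.
by case: ifP => _ //; rewrite fsbig1.
Qed.

Definition gf I (A : set I) (u v : I -> nat) :=
  fps2_sum A (fun i => mon R (u i) (v i)).

(** Bounding the exponents, rather than fixing them, makes the condition stable under increasing the
    weights, as the induction on pairs requires. *)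
Definition locally_finite I (A : set I) (u v : I -> nat) :=
  forall a b, finite_set [set i | [/\ A i, (u i <= a)%N & (v i <= b)%N]].

Lemma locally_finite_summable I (A : set I) u v :
  locally_finite A u v -> fps2_summable A (fun i => mon R (u i) (v i)).
Proof.
move=> fA a b; apply: sub_finite_set (fA a b) => i [Ai].
by rewrite fcoef2_mon; case: andP => //= -[/eqP<- /eqP<-].
Qed.

Lemma locally_finite_sub I (A B : set I) u v :
  A `<=` B -> locally_finite B u v -> locally_finite A u v.
Proof.
move=> AB fB a b; apply: sub_finite_set (fB a b) => i [Ai ua vb].
by split=> //; apply: AB.
Qed.

Lemma locally_finite_image I J (A : set I) (h : I -> J) u v :
  locally_finite A (u \o h) (v \o h) -> locally_finite (h @` A) u v.
Proof.
move=> fA a b; apply: sub_finite_set (finite_image h (fA a b)).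
by move=> _ [[i Ai <-] ua vb]; exists i.
Qed.

Lemma locally_finiteD I (A : set I) u v (u' v' : I -> nat) :
  locally_finite A u v ->
  locally_finite A (fun i => u i + u' i)%N (fun i => v i + v' i)%N.
Proof.
move=> fA a b; apply: sub_finite_set (fA a b) => i [Ai ua vb].
by split=> //; lia.
Qed.

Section Geometric.
Variables (I : choiceType) (A : set I) (u v : I -> nat) (p q : nat).
Hypotheses (pq : (0 < p + q)%N) (fA : locally_finite A u v).

Let u' (j : I * nat) := (u j.1 + p * j.2)%N.
Let v' (j : I * nat) := (v j.1 + q * j.2)%N.

Lemma locally_finiteX : locally_finite (A `*` [set: nat])%classic u' v'.
Proof.
move=> a b.
(* Since p + q > 0, the new index satisfies k <= (p + q) k <= a + b. *)
apply: sub_finite_set (finite_setX (fA a b) (finite_II (a + b).+1)).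
rewrite /u' /v' => -[i k] /= [[Ai _] ua vb]; split; first by split=> //; lia.
by rewrite /=; nia.
Qed.

Lemma gf_geometric :
  (1 - mon R p q) * gf (A `*` [set: nat])%classic u' v' = gf A u v.
Proof.
set B := (A `*` _)%classic.
pose h (j : I * nat) := (j.1, j.2.+1).
have BE : B = ((fun i => (i, 0%N)) @` A `|` h @` B)%classic.
  apply/seteqP; split=> [[i [|k]] [/= Ai _]|j].
  - by left; exists i.
  - by right; exists (i, k).
  - by case=> [[i Ai <-]|[[i k] [/= Ai _] <-]].
have lB := locally_finiteX.
rewrite mulrBl mul1r; apply/eqP; rewrite subr_eq; apply/eqP.
rewrite {1}/gf {1}BE fps2_sumU.
- congr (_ + _).
    rewrite fps2_sum_image; last by move=> i j _ _ [].
    by apply: eq_fps2_sum => i _ /=; rewrite /u' /v' /= !muln0 !addn0.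
  rewrite fps2_sum_image; last by move=> [i k] [j l] _ _ [-> ->].
  rewrite -fps2_sum_monM; apply: eq_fps2_sum => -[i k] _ /=.
  by rewrite monM /u' /v' /=; congr (mon R _ _); lia.
- apply/locally_finite_summable/(locally_finite_sub _ lB).
  by move=> _ [i Ai <-].
- apply/locally_finite_summable/(locally_finite_sub _ lB).
  by move=> _ [[i k] [/= Ai _] <-].
- by move=> j [[i _ <-] [k _ []]].
Qed.

End Geometric.

End FormalSums.

(** * Building the partitions of [calG] pair by pair *)

Section Partitions.
Local Open Scope nat_scope.

(** A new first part shifts all indices by one, which exchanges the two parities. *)
Lemma odd_weight_cons a la : odd_weight (a :: la) = a + even_weight la.
Proof.
rewrite /odd_weight /even_weight big_ltn_cond //= [in LHS]big_add1 /=.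
congr (_ + _); rewrite big_nat_cond [RHS]big_nat_cond.
by apply: eq_big => [[|i]|[|i]].
Qed.

Lemma even_weight_cons a la : even_weight (a :: la) = odd_weight la.
Proof.
rewrite /odd_weight /even_weight big_ltn_cond //= [in LHS]big_add1 /=.
rewrite big_nat_cond [RHS]big_nat_cond; apply: eq_big => [[|i]|[|i]] //=.
by rewrite negbK.
Qed.

Lemma weight_nil : (odd_weight [::] = 0) * (even_weight [::] = 0).
Proof. by rewrite /odd_weight /even_weight !big_geq. Qed.

Lemma distinct_partition_cons a la :
  distinct_partition (a :: la) = (head 0 la < a) && distinct_partition la.
Proof.
rewrite /distinct_partition; case: la => [|b la] /=.
  by rewrite inE andbT lt0n eq_sym.
rewrite !inE -!andbA; case: ltnP => //= ba; congr (_ && _).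
by rewrite negb_or; case: a ba.
Qed.

Lemma calG_nil : calG [::].
Proof. by split. Qed.

Lemma calG_seq1 a : calG [:: a] <-> 0 < a.
Proof.
split=> [[]|a0]; first by rewrite distinct_partition_cons => /andP[].
by split; rewrite ?distinct_partition_cons ?a0 // => -[|[]].
Qed.

(** The default 0 of [head] acts as a part after the last one: for empty [la] the parity condition
    says that [b] is even, which is the condition on the smallest part. *)
Lemma calG_cons2 a b la :
  calG [:: a, b & la] <->
    [/\ b < a, head 0 la < b, ~~ odd (b - head 0 la) & calG la].
Proof.
(* The case i = 0 is excluded because [part la 0] is again the first part of [la], not [b]. *)
have partE i : 0 < i -> part [:: a, b & la] i.+2 = part la i by case: i.
split=> [[]|[ba lab gap [dla gaps last]]].
  rewrite !distinct_partition_cons /= => /and3P[ba lab dla] gaps last.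
  split=> //.
    case: la {partE lab dla} gaps last => [|c la] gaps last.
      by rewrite subn0; apply: last.
    by apply: (gaps 1).
  split=> // [i i0 il|].
    have i2 : 0 < 2 * i by rewrite muln_gt0.
    by have := gaps i.+1 isT; rewrite mulnS !add2n !partE //;
      apply; rewrite !ltnS.
  by rewrite -[odd (size la)]negbK => s0 /(last isT); rewrite partE.
split; first by rewrite !distinct_partition_cons /= ba lab.
  case=> [//|[|i]] _ /= il.
    by case: la il gap {partE lab dla gaps last}.
  by move: il; rewrite mulnS !add2n !ltnS !partE // => il; apply: gaps.
move=> _ /=; rewrite negbK.
case: la gap last {partE lab dla gaps} => [|c la] gap last.
  by rewrite subn0 in gap.
by move=> os; apply: last.
Qed.

(* The number of pairs is the half of the length, rounded up. *)
Definition calG_ n : set (seq nat) :=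
  [set la | calG la /\ uphalf (size la) = n]%classic.

Lemma calG_0 : calG_ 0 = [set [::]]%classic.
Proof.
apply/seteqP; split=> [[|a la] [] //|_ ->].
by split=> //; apply: calG_nil.
Qed.

(* b = 0 happens only for la = [::] and c = 0; the padding 0 is then not a
   part. *)
Definition top_pair (t : seq nat * nat * nat) : seq nat :=
  let: (la, c, d) := t in
  let b := head 0 la + (la != [::]).*2 + c.*2 in
  (b + d).+1 :: if b == 0 then [::] else b :: la.

Lemma top_pair_eq0 (la : seq nat) c :
  head 0 la + (la != [::]).*2 + c.*2 = 0 -> la = [::] /\ c = 0.
Proof. by case: la => [|a la] /= H; [split=> //; lia|lia]. Qed.

(** What follows the top pair is [la]; then the second part gives [c] and the first gives [d]. A
    missing second part forces [la] empty and c = 0. *)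
Lemma top_pair_inj : injective top_pair.
Proof.
move=> [[la c] d] [[la' c'] d'] /= [].
case: (_ =P 0) => [/top_pair_eq0[-> ->]|_].
  case: (_ =P 0) => [/top_pair_eq0[-> ->]|_] //.
  by move=> /addnI->.
case: (_ =P 0) => // _ e [b ela].
by rewrite -ela in e b *; congr (_, _, _); lia.
Qed.

Lemma top_pair_image n :
  (top_pair @` ((calG_ n `*` [set: nat]) `*` [set: nat]) = calG_ n.+1)%classic.
Proof.
apply/seteqP; split=> [_ [[[la c] d] /= [[[Gla sla] _] _] <-]|la [Gla sla]].
  case: (_ =P 0) => [/top_pair_eq0 [la0 c0]|/eqP b0].
    split; last by rewrite -sla la0.
    exact/calG_seq1.
  split; last by rewrite -sla.
  apply/calG_cons2; split=> //.
  - by rewrite ltnS leq_addr.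
  - by case: (la) b0 => [|x l] /=; lia.
  - by rewrite -addnA addKn oddD !odd_double.
case: la Gla sla => [//|a [|b la]] Gla sla.
  (* A single part a is the pair (a, 0), so b = 0 and d = a - 1. *)
  exists ([::], 0, a.-1) => /=.
    by split=> //; split=> //; split; [apply: calG_nil|case: sla].
  by move/calG_seq1: Gla => a0; rewrite add0n prednK.
case/calG_cons2: Gla => ba lab gap Gla.
(* The gap [b - head 0 la] is even and positive, so its half is at least 1; for nonempty [la] one
   unit of it is the 2 already added by [top_pair]. *)
have e :
  head 0 la + (la != [::]).*2 + ((b - head 0 la)./2 - (la != [::])).*2 = b.
  rewrite doubleB even_halfK // -addnA subnKC ?subnKC //; first exact: ltnW.
  by case: (la != [::]) => //=; lia.
exists (la, (b - head 0 la)./2 - (la != [::]), a - b.+1) => /=.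
  by split=> //; split=> //; split=> //; case: sla.
rewrite e -addSn subnKC //; case: (_ =P 0) => // b0.
by rewrite b0 in lab.
Qed.

Lemma head_top_pair la c d : head 0 (top_pair (la, c, d)) =
  (head 0 la + (la != [::]).*2 + c.*2 + d).+1.
Proof. by []. Qed.

Lemma odd_weight_top_pair la c d :
  odd_weight (top_pair (la, c, d)) =
    head 0 (top_pair (la, c, d)) + odd_weight la.
Proof.
rewrite [in LHS]/= odd_weight_cons; congr (_ + _).
case: (_ =P 0) => [/top_pair_eq0[-> _]|_]; last by rewrite even_weight_cons.
by rewrite !weight_nil.
Qed.

Lemma even_weight_top_pair la c d :
  even_weight (top_pair (la, c, d)) =
    head 0 la + (la != [::]).*2 + c.*2 + even_weight la.
Proof.
rewrite [in LHS]/= even_weight_cons.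
case: (_ =P 0) => [b0|_]; last by rewrite odd_weight_cons.
by have [-> ->] := top_pair_eq0 b0; rewrite !weight_nil.
Qed.

End Partitions.

(** * The recursion for the generating functions of [calG_ n] and its solution *)

Section GeneratingFunction.
Variable R : comNzRingType.

(** Both parts of a new pair contain the old first part as a summand, so a multiple k of the new
    first part turns into the multiple k + 1 of the old one; the parameter k closes the
    recursion. *)
Definition oddw k la := (odd_weight la + k * head 0%N la)%N.
Definition evenw k la := (even_weight la + k * head 0%N la)%N.

(** In [calG_ n] only n = 0 gives the empty partition, so [la != [::]] becomes the constant [0 < n]
    and the added exponent does not depend on [la]. *)
Lemma oddw_top_pair n k t :
  (calG_ n `*` [set: nat] `*` [set: nat])%classic t ->
  oddw k (top_pair t) =
    (oddw k.+1 t.1.1 + k.+1 * ((0 < n).*2).+1 + k.+1.*2 * t.1.2 + k.+1 * t.2)%N.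
Proof.
case: t => -[la c] d [] [] [Gla <-] _ _; rewrite /oddw.
rewrite odd_weight_top_pair head_top_pair /=.
by case: la Gla => [|a la] _ /=; nia.
Qed.

Lemma evenw_top_pair n k t :
  (calG_ n `*` [set: nat] `*` [set: nat])%classic t ->
  evenw k (top_pair t) =
    (evenw k.+1 t.1.1 + (k.+1 * (0 < n).*2 + k) + k.+1.*2 * t.1.2 + k * t.2)%N.
Proof.
case: t => -[la c] d [] [] [Gla <-] _ _; rewrite /evenw.
rewrite even_weight_top_pair head_top_pair /=.
by case: la Gla => [|a la] _ /=; nia.
Qed.

(** The case (n + 1, k) follows from (n, k + 1), hence the induction with k free. The indices c and
    d enter with slopes (2(k+1), 2(k+1)) and (k+1, k), never (0, 0). *)
Lemma calG_n_locally_finite n k : locally_finite (calG_ n) (oddw k) (evenw k).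
Proof.
elim: n k => [|n IHn] k.
  move=> a b; apply: sub_finite_set (finite_set1 [::]).
  by rewrite calG_0 => la [].
rewrite -top_pair_image; apply: locally_finite_image => a b.
have lf : locally_finite (calG_ n `*` [set: nat] `*` [set: nat])%classic
    (fun t => oddw k.+1 t.1.1 + k.+1 * ((0 < n).*2).+1 +
       k.+1.*2 * t.1.2 + k.+1 * t.2)%N
    (fun t => evenw k.+1 t.1.1 + (k.+1 * (0 < n).*2 + k) +
       k.+1.*2 * t.1.2 + k * t.2)%N.
  have lf1 := locally_finiteD (fun=> k.+1 * ((0 < n).*2).+1)%N
    (fun=> k.+1 * (0 < n).*2 + k)%N (IHn k.+1).
  have lf2 := @locally_finiteX _ _ _ _ k.+1.*2 k.+1.*2 isT lf1.
  exact: (@locally_finiteX _ _ _ _ k.+1 k isT lf2).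
apply: sub_finite_set (lf a b) => t [Gt].
by rewrite /= (oddw_top_pair _ Gt) (evenw_top_pair _ Gt).
Qed.

Lemma gf_calG_step n k :
  (1 - mon R k.+1.*2 k.+1.*2) *
    ((1 - mon R k.+1 k) * gf R (calG_ n.+1) (oddw k) (evenw k)) =
  mon R (k.+1 * ((0 < n).*2).+1) (k.+1 * (0 < n).*2 + k) *
    gf R (calG_ n) (oddw k.+1) (evenw k.+1).
Proof.
pose cx := (k.+1 * ((0 < n).*2).+1)%N; pose cy := (k.+1 * (0 < n).*2 + k)%N.
have lf : locally_finite (calG_ n) (fun la => oddw k.+1 la + cx)%N
    (fun la => evenw k.+1 la + cy)%N.
  exact/locally_finiteD/calG_n_locally_finite.
rewrite -top_pair_image {1}/gf fps2_sum_image; last first.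
  by move=> s t _ _; apply: top_pair_inj.
rewrite (_ : fps2_sum _ _ = gf R (calG_ n `*` [set: nat] `*` [set: nat])%classic
    (fun t => (oddw k.+1 t.1.1 + cx + k.+1.*2 * t.1.2) + k.+1 * t.2)%N
    (fun t => (evenw k.+1 t.1.1 + cy + k.+1.*2 * t.1.2) + k * t.2)%N);
  last first.
  apply: eq_fps2_sum => t Gt /=.
  by rewrite (oddw_top_pair _ Gt) (evenw_top_pair _ Gt).
have lf2 := @locally_finiteX _ _ _ _ k.+1.*2 k.+1.*2 isT lf.
(* The sum over d is the outer one and goes first; the sum over c follows. *)
rewrite (@gf_geometric R _ _ _ _ k.+1 k isT lf2).
rewrite (@gf_geometric R _ _ _ _ k.+1.*2 k.+1.*2 isT lf).
rewrite /gf -fps2_sum_monM; apply: eq_fps2_sum => la _.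
by rewrite monM addnC [(_ + cy)%N]addnC.
Qed.

(** Iterating the recursion leads from (n, k) to (0, k + n), where the sum is 1. With the
    denominators kept on the left, only exponents are compared; [3 * n - 2] truncates to 0 at n = 0,
    as it should. *)
Lemma gf_calG_closed n k :
  \prod_(i < n) ((1 - mon R (k + i).+1 (k + i)) *
                 (1 - mon R (k + i).+1.*2 (k + i).+1.*2)) *
    gf R (calG_ n) (oddw k) (evenw k) =
  mon R ((3 * n ^ 2 - n) %/ 2 + (3 * n - 2) * k)
        ((3 * n ^ 2 - 3 * n) %/ 2 + (3 * n - 2) * k).
Proof.
elim: n k => [|n IHn] k.
  rewrite big_ord0 mul1r calG_0 /gf fps2_sum_set1 /oddw /evenw /=.
  by rewrite !weight_nil !muln0.
rewrite big_ord_recl addn0.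
under eq_bigr do rewrite lift0 addnS -addSn.
have := IHn k.+1; set P := (X in X * _ = _) => IH.
transitivity (P * ((1 - mon R k.+1.*2 k.+1.*2) *
    ((1 - mon R k.+1 k) * gf R (calG_ n.+1) (oddw k) (evenw k)))).
  by rewrite -/P [_ * P]mulrC -!mulrA; congr (_ * _); rewrite mulrCA.
rewrite gf_calG_step mulrCA IH monM; congr (mon R _ _).
  (* The increment is written as a multiple of 2 so that it leaves the integer quotient. *)
  have -> : (3 * n.+1 ^ 2 - n.+1 = 3 * n ^ 2 - n + (3 * n).+1 * 2)%N by nia.
  by rewrite divnDMl //; case: n {IHn P IH} => [|n] /=; nia.
have -> : (3 * n.+1 ^ 2 - 3 * n.+1 = 3 * n ^ 2 - 3 * n + (3 * n) * 2)%N by nia.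
by rewrite divnDMl //; case: n {IHn P IH} => [|n] /=; nia.
Qed.

End GeneratingFunction.

(** * Summation over the number of pairs *)

Lemma oddw0 : oddw 0 = odd_weight.
Proof. by apply/funext => la; rewrite /oddw addn0. Qed.

Lemma evenw0 : evenw 0 = even_weight.
Proof. by apply/funext => la; rewrite /evenw addn0. Qed.

(** Each pair has a positive larger part, counted by [odd_weight]. Hence only n <= a contributes to
    the coefficient of x^a. *)
Lemma uphalf_size_le_odd_weight la :
  calG la -> (uphalf (size la) <= odd_weight la)%N.
Proof.
move: {2}(uphalf _) (erefl (uphalf (size la))) => n.
elim: n la => [|n IHn] la sla Gla; rewrite sla //.
have : calG_ n.+1 la by [].
rewrite -top_pair_image => -[[[mu c] d] [[[Gmu smu] _] _] <-].
rewrite odd_weight_top_pair head_top_pair addSn ltnS.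
by rewrite -{1}smu (leq_trans (IHn _ smu Gmu)) // leq_addl.
Qed.

Lemma calG_locally_finite : locally_finite calG odd_weight even_weight.
Proof.
move=> a b; apply: sub_finite_set (bigcup_finite (finite_II a.+1) (fun n _ =>
  @calG_n_locally_finite n 0 a b)) => la [Gla oa eb].
exists (uphalf (size la)); last by rewrite oddw0 evenw0.
by rewrite /= ltnS (leq_trans (uphalf_size_le_odd_weight Gla)).
Qed.

Lemma fcoef2_sum (R : comNzRingType) n (F : 'I_n -> {fps {fps R}}) a b :
  fcoef2 (\sum_(i < n) F i) a b = \sum_(i < n) fcoef2 (F i) a b.
Proof. by elim/big_rec2: _ => //= i f g _ <-. Qed.

Lemma gf_calG_lt (R : comNzRingType) N :
  gf R [set la | calG la /\ (uphalf (size la) < N)%N]%classic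
    odd_weight even_weight =
  \sum_(n < N) gf R (calG_ n) odd_weight even_weight.
Proof.
elim: N => [|N IHN].
  rewrite big_ord0; apply: fps2P => a b; rewrite /fcoef2 /= fsbig1 //.
  by move=> la [].
rewrite big_ord_recr /= -IHN -fps2_sumU.
- congr fps2_sum; apply/seteqP; split=> la /=.
    by move=> [Gla]; rewrite ltnS leq_eqVlt => /predU1P[|]; [right|left].
  by case=> -[Gla]; [move=> /ltnW|move=> ->].
- apply/locally_finite_summable/(locally_finite_sub _ calG_locally_finite).
  by move=> la [].
- apply/locally_finite_summable/(locally_finite_sub _ calG_locally_finite).
  by move=> la [].
- by move=> la [[_ +] [_ sla]]; rewrite sla ltnn.
Qed.

Lemma fcoef2_gf_calG (R : comNzRingType) a b :
  fcoef2 (gf R calG odd_weight even_weight) a b =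
  \sum_(n < a.+1) fcoef2 (gf R (calG_ n) odd_weight even_weight) a b.
Proof.
rewrite -fcoef2_sum -gf_calG_lt /fcoef2 /=; apply/esym/fsbig_widen.
  by move=> la [].
move=> la [Gla nla] /=; rewrite -/(fcoef2 _ a b) fcoef2_mon.
case: eqP => //= oa; case: nla; split=> //.
by rewrite ltnS -oa uphalf_size_le_odd_weight.
Qed.

Theorem theorem5p4 :
  let x := fps2X int in
  let y := fps2Y int in
  let lhs := fun la : seq nat => x ^+ odd_weight la * y ^+ even_weight la in
  let rhs := fun n : nat =>
    x ^+ ((3 * n ^ 2 - n) %/ 2) * y ^+ ((3 * n ^ 2 - 3 * n) %/ 2)
      / (qpoch x (x * y) n * qpoch (x ^+ 2 * y ^+ 2) (x ^+ 2 * y ^+ 2) n) in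
  [/\ fps2_summable calG lhs,
      fps2_summable [set: nat]%classic rhs
    & fps2_sum calG lhs = fps2_sum [set: nat]%classic rhs].
Proof.
move=> x y lhs rhs.
have rhsE n : rhs n = gf _ (calG_ n) odd_weight even_weight.
  have U : qpoch x (x * y) n * qpoch (x ^+ 2 * y ^+ 2) (x ^+ 2 * y ^+ 2) n
      \is a GRing.unit.
    have x0 : fcoef x 0 = 0 by [].
    have xy0 : fcoef (x ^+ 2 * y ^+ 2) 0 = 0.
      by rewrite expr2 -mulrA fcoef0M x0 mul0r.
    by rewrite unitrM; apply/andP; split; apply: qpoch_fps_unit.
  (* Clearing the denominator leaves the closed form at k = 0. *)
  apply: (mulIr U); rewrite divrK //.
  have := gf_calG_closed int n 0; rewrite oddw0 evenw0 !muln0 !addn0.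
  rewrite -/(mon _ _ _) => <-; rewrite mulrC /qpoch -big_split /=; congr (_ * _).
  have xE : x = mon int 1 0 by rewrite /mon mulr1.
  have yE : y = mon int 0 1 by rewrite /mon mul1r.
  apply: eq_bigr => i _; rewrite xE yE !(monX, monM).
  by congr ((1 - mon _ _ _) * (1 - mon _ _ _)); lia.
(* For n >= 1 one has 3 n^2 - n >= 2 n, so the n-th numerator is divisible by x^n. *)
have rhs0 n a b : (a < n)%N -> fcoef2 (rhs n) a b = 0.
  move=> an; rewrite /rhs -/(mon int _ _) fcoef2_monM ifN //.
  by rewrite negb_and -ltnNge (leq_trans an) // leq_divRL //; nia.
split.
- exact/locally_finite_summable/calG_locally_finite.
- move=> a b; apply: sub_finite_set (finite_II a.+1) => n [_ /= /eqP].
  by apply: contraNT; rewrite -leqNgt => /rhs0->.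
apply: fps2P => a b; rewrite -/(gf int calG _ _) fcoef2_gf_calG.
under eq_bigr do rewrite -rhsE.
rewrite (@fsbig_ord _ _ _ _ (fun n => fcoef2 (rhs n) a b)) /fcoef2 /=.
apply: fsbig_widen => // n [_ /= /negP]; rewrite -leqNgt.
exact: rhs0.
Qed.
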